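(* Let $q\in(0,1)$ and let $\mathcal{G}$ be a loopfree quantum graph on the quantum set $(M_2,\psi_q)$. (1) If $\mathcal{G}$ has exactly one quantum edge, then it is isomorphic to exactly one of the following quantum graphs. (a) The quantum graph $\mathcal{G}_0^{(q,1B)}$ with quantum edge space $\mathrm{span}\{\mathrm{diag}(q^{-2},-1)\}$, given by the quantum adjacency matrix $$A_0^{(q,1B)}=\begin{pmatrix} q^{-2} & 0 & 0 & 0 \\ 0 & -1 & 0 & 0 \\ 0 & 0 & -1 & 0 \\ 0 & 0 & 0 & q^2 \end{pmatrix}.$$ This quantum graph is both GNS- and KMS-undirected. (b) The quantum graph $\mathcal{G}_{0,\beta,\gamma}^{(q,1C)}$ with quantum edge space $\mathrm{span}\left\{\begin{pmatrix} q^{-2}\gamma & 1+\beta \\ 1-\beta & -\gamma \end{pmatrix}\right\}$, where $\beta\in[-1,1]$ and $\gamma\in\mathbb{C}$ are such that $$|\beta|<1\implies\gamma\ge0,\qquad|\beta|=1\implies\arg(\gamma)\in[0,\pi),$$ given by the quantum adjacency matrix $$A_{0,\beta,\gamma}^{(q,1C)}=c^{-1}\begin{pmatrix} q^{-4}|\gamma|^2 & q^{-\frac32}\beta_+\gamma & q^{-\frac32}\beta_+\overline{\gamma} & q\beta_+^2 \\ q^{-\frac52}\beta_-\gamma & -q^{-2}|\gamma|^2 & \beta_+\beta_- & -q^{\frac12}\beta_+\overline{\gamma} \\ q^{-\frac52}\beta_-\overline{\gamma} & \beta_+\beta_- & -q^{-2}|\gamma|^2 & -q^{\frac12}\beta_+\gamma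 \\ q^{-1}\beta_-^2 & -q^{-\frac12}\beta_-\overline{\gamma} & -q^{-\frac12}\beta_-\gamma & |\gamma|^2 \end{pmatrix},$$ where $\beta_+=1+\beta$, $\beta_-=1-\beta$ and $c=\frac{1}{1+q^2}\left((q^{-2}+1)|\gamma|^2+2q(1+\beta^2)\right)$. This quantum graph is not GNS-undirected, and it is KMS-undirected if and only if $\beta=0$ (and $\gamma\ge0$). (2) If $\mathcal{G}$ has two quantum edges, then it is isomorphic to the loopfree complement of one of the quantum graphs from (1). (3) If $\mathcal{G}$ has three quantum edges, then it is the complete loopfree quantum graph on $(M_2,\psi_q)$, i.e. its quantum edge space is the orthogonal complement of $\mathbb{C}\mathrm{I}_2$.
   Context: $M_2$ is the algebra of complex $2\times2$ matrices. For $q\in(0,1)$ let $\rho_q=(1+q^2)\,\mathrm{diag}(q^{-2},1)$ and $\psi_q=\mathrm{Tr}(\rho_q\,\cdot)$. A quantum graph on $(M_2,\psi_q)$ is given by its quantum edge space, an arbitrary linear subspace $S\subset M_2$; the number of quantum edges is $\dim S$. The KMS-inner product induced by $\psi_q^{-1}$ is $\langle x,y\rangle=\mathrm{Tr}(x^*\rho_q^{-1/2}y\rho_q^{-1/2})$; orthogonality and orthogonal complements of edge spaces are taken with respect to it. If $(X_i)_i$ is an orthonormal basis of $S$ for this inner product, the quantum adjacency matrix is the linear map $A:M_2\to M_2$, $x\mapsto\sum_i\rho_q^{-1/4}X_i\rho_q^{1/4}x\rho_q^{1/4}X_i^*\rho_q^{-1/4}$ (independent of the choice of basis), written as a $4\times4$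 matrix in the ordered basis $e_{11},e_{12},e_{21},e_{22}$ of matrix units, i.e. $A=\sum_i(\rho_q^{-1/4}X_i\rho_q^{1/4})\otimes\overline{(\rho_q^{-1/4}X_i\rho_q^{1/4})}$ (Kronecker product). The quantum graph is loopfree if $\mathrm{I}_2\perp S$; KMS-undirected if $S=S^*:=\{x^*:x\in S\}$; GNS-undirected if $S=S^*$ and $\rho_qS\rho_q^{-1}=S$. Two quantum graphs on $(M_2,\psi_q)$ with edge spaces $S_1,S_2$ are isomorphic if there is a $*$-automorphism $\pi$ of $M_2$ with $\psi_q\circ\pi=\psi_q$ and $\pi(S_1)=S_2$. The loopfree complement of a loopfree quantum graph with edge space $S$ is the quantum graph with edge space $S'$, where $S^\perp=S'\oplus\mathbb{C}\mathrm{I}_2$ is an orthogonal direct sum. $\arg$ denotes the argument of a complex number.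
   Formalization: The printed conditions on γ in (1)(b) are interchanged: the theorem takes arg(γ)∈[0,π) (with arg 0 = 0) when |β|<1 and γ≥0 when |β|=1; as printed, both existence (β=0, γ=i) and uniqueness (β=1, γ=1 and γ=i) fail. *)

(* Defs.v *)
From HB Require Import structures.
From mathcomp Require Import all_boot all_order all_algebra.
From mathcomp Require Import complex.
From mathcomp Require Import all_classical all_reals all_analysis.

Set Implicit Arguments.
Unset Strict Implicit.
Unset Printing Implicit Defensive.

Import Order.TTheory GRing.Theory Num.Theory.
Local Open Scope classical_set_scope.
Local Open Scope ring_scope.
Local Open Scope complex_scope.

Section Defs.
Variable R : realType.
Local Notation C := R[i].
Local Notation M2 := 'M[C]_2.

(* Principal argument, in ]-pi, pi], with the convention carg 0 = 0. *)
Definition carg (z : C) : R :=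
  if z == 0 then 0
  else let t := acos (complex.Re z / Num.sqrt (complex.Re z ^+ 2 + complex.Im z ^+ 2)) in
       if 0 <= complex.Im z then t else - t.

Definition mx_of_rows (n : nat) (s : seq (seq C)) : 'M[C]_n :=
  \matrix_(i, j) nth 0 (nth [::] s i) j.

Definition dagger (x : M2) : M2 := (map_mx conjc x)^T.

Definition rho (q : R) : M2 :=
  ((1 + q ^+ 2)%:C) *: mx_of_rows 2 [:: [:: (q ^- 2)%:C; 0]; [:: 0; 1]].

Definition psi (q : R) (x : M2) : C := \tr (rho q *m x).

Definition rho_eig (q : R) (i : 'I_2) : R :=
  (1 + q ^+ 2) * (if i == 0 then q ^- 2 else 1).

(* The real power rho_q^t (functional calculus of the diagonal matrix rho_q). *)
Definition rho_pow (q t : R) : M2 :=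
  diag_mx (\row_i (rho_eig q i `^ t)%:C).

Lemma rho_pow1 (q : R) : rho_pow q 1 = rho q.
Proof.
have q2 : 0 <= q ^- 2 by rewrite invr_ge0 sqr_ge0.
have q1 : 0 <= 1 + q ^+ 2 by rewrite addr_ge0 ?ler01 ?sqr_ge0.
apply/matrixP => i j; rewrite !mxE /rho_eig.
rewrite powRr1; last by case: ifP => _; rewrite mulr_ge0.
by case: i => [[|[|[]]] ?] //; case: j => [[|[|[]]] ?] //=;
  rewrite ?mulr0n ?mulr1n ?mulr0 //= rmorphM /= ?rmorph1.
Qed.

Lemma rho_powD (q s t : R) : 0 < q ->
  rho_pow q (s + t) = rho_pow q s *m rho_pow q t.
Proof.
move=> q0; have eig0 i : rho_eig q i != 0.
  have q2 : 0 < q ^+ 2 by rewrite exprn_gt0.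
  rewrite gt_eqF // /rho_eig mulr_gt0 ?addr_gt0 ?ltr01 //.
  by case: ifP; rewrite ?invr_gt0.
rewrite mulmx_diag; congr diag_mx; apply/rowP => i; rewrite !mxE.
by rewrite powRD ?rmorphM //; apply/implyP.
Qed.

Definition kms (q : R) (x y : M2) : C :=
  \tr (dagger x *m rho_pow q (- (1 / 2)) *m y *m rho_pow q (- (1 / 2))).

Definition kms_perp (q : R) (S : {vspace M2}) : set M2 :=
  [set y | forall x, x \in S -> kms q x y = 0].

Definition is_orthonormal_basis (q : R) (S : {vspace M2}) (X : seq M2) : Prop :=
  basis_of S X /\
  forall i j, (i < size X)%N -> (j < size X)%N ->
    kms q X`_i X`_j = (i == j)%:R.

Definition adjacency_map (q : R) (X : seq M2) (x : M2) : M2 :=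
  \sum_(Xi <- X)
    rho_pow q (- (1 / 4)) *m Xi *m rho_pow q (1 / 4) *m x
    *m rho_pow q (1 / 4) *m dagger Xi *m rho_pow q (- (1 / 4)).

(* The 4 x 4 matrix of a linear map on M2 in the ordered basis
   e11, e12, e21, e22 (acting on column vectors): with zero-based indices, the
   k-th matrix unit is delta_mx (k / 2) (k mod 2). *)
Definition matrix_of_map (f : M2 -> M2) : 'M[C]_4 :=
  \matrix_(k, l)
    f (delta_mx (inord (l %/ 2)) (inord (l %% 2))) (inord (k %/ 2)) (inord (k %% 2)).

(* A is the quantum adjacency matrix of the quantum graph with edge space S;
   both the existence of an orthonormal basis and the independence of its
   choice are part of the assertion. *)
Definition is_quantum_adjacency_matrix (q : R) (S : {vspace M2}) (A : 'M[C]_4) : Prop :=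
  (exists X, is_orthonormal_basis q S X) /\
  (forall X, is_orthonormal_basis q S X -> matrix_of_map (adjacency_map q X) = A).

Definition loopfree (q : R) (S : {vspace M2}) : Prop :=
  forall x, x \in S -> kms q 1%:M x = 0.

Definition kms_undirected (S : {vspace M2}) : Prop :=
  [set` S] = dagger @` [set` S].

Definition gns_undirected (q : R) (S : {vspace M2}) : Prop :=
  kms_undirected S /\
  (fun x => rho q *m x *m invmx (rho q)) @` [set` S] = [set` S].

Definition star_automorphism (pi : M2 -> M2) : Prop :=
  [/\ linear pi, bijective pi, {morph pi : x y / x *m y} & {morph pi : x / dagger x}].

Definition isomorphic (q : R) (S1 S2 : {vspace M2}) : Prop :=
  exists pi : M2 -> M2,
    [/\ star_automorphism pi, forall x, psi q (pi x) = psi q x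
      & pi @` [set` S1] = [set` S2]].

(* S' is the edge space of the loopfree complement of the quantum graph with
   edge space S: the orthogonal complement of S is the orthogonal direct sum of
   S' and the line spanned by the unit. *)
Definition is_loopfree_complement (q : R) (S S' : {vspace M2}) : Prop :=
  [/\ kms_perp q S = [set` (S' + <[1%:M : M2]>)%VS],
      directv (S' + <[1%:M : M2]>)
    & forall x, x \in S' -> kms q 1%:M x = 0].

Inductive one_edge_graph : Type :=
| G1B
| G1C (beta : R) (gamma : C).

(* Diagonal unitary conjugations and scalings of the edge vector that fix its
   off-diagonal part (1 + beta, 1 - beta) act on gamma by +-1 if |beta| < 1 and
   by all phases if |beta| = 1. The normal forms of gamma are therefore the half
   plane 0 <= arg gamma < pi, resp. the half line 0 <= gamma. (In the source the
   two conclusions are printed in the opposite order, which gives neither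
   existence nor uniqueness of the normal form.) *)
Definition admissible (beta : R) (gamma : C) : Prop :=
  [/\ -1 <= beta <= 1,
      `|beta| < 1 -> 0 <= carg gamma < pi
    & `|beta| = 1 -> 0 <= gamma].

Definition listed (G : one_edge_graph) : Prop :=
  if G is G1C beta gamma then admissible beta gamma else True.

Definition edge_vector (q : R) (G : one_edge_graph) : M2 :=
  match G with
  | G1B => mx_of_rows 2 [:: [:: (q ^- 2)%:C; 0]; [:: 0; -1]]
  | G1C beta gamma =>
      mx_of_rows 2 [:: [:: (q ^- 2)%:C * gamma; (1 + beta)%:C];
                       [:: (1 - beta)%:C; - gamma]]
  end.

Definition edge_space (q : R) (G : one_edge_graph) : {vspace M2} :=
  <[edge_vector q G]>%VS.

Definition A1B (q : R) : 'M[C]_4 :=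
  mx_of_rows 4 [:: [:: (q ^- 2)%:C; 0; 0; 0];
                   [:: 0; -1; 0; 0];
                   [:: 0; 0; -1; 0];
                   [:: 0; 0; 0; (q ^+ 2)%:C]].

Definition A1C (q beta : R) (gamma : C) : 'M[C]_4 :=
  let bp := (1 + beta)%:C in
  let bm := (1 - beta)%:C in
  let g := gamma in
  let g' := gamma^* in
  let qp t := (q `^ t)%:C in
  let c := (1 / (1 + q ^+ 2))%:C *
           ((q ^- 2 + 1)%:C * `|g| ^+ 2 + (2 * q * (1 + beta ^+ 2))%:C) in
  c^-1 *: mx_of_rows 4
    [:: [:: (q ^- 4)%:C * `|g| ^+ 2; qp (- (3 / 2)) * bp * g;
            qp (- (3 / 2)) * bp * g'; q%:C * bp ^+ 2];
        [:: qp (- (5 / 2)) * bm * g; - ((q ^- 2)%:C * `|g| ^+ 2);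
            bp * bm; - (qp (1 / 2) * bp * g')];
        [:: qp (- (5 / 2)) * bm * g'; bp * bm;
            - ((q ^- 2)%:C * `|g| ^+ 2); - (qp (1 / 2) * bp * g)];
        [:: (q^-1)%:C * bm ^+ 2; - (qp (- (1 / 2)) * bm * g');
            - (qp (- (1 / 2)) * bm * g); `|g| ^+ 2]].

End Defs.

Arguments G1B {R}.

(* Main.v *)
(* A *-automorphism of M2 preserving psi_q fixes e11, because e11 is the only
   projection with its psi_q-value; hence it is conjugation by a diagonal
   unitary, i.e. it multiplies the (1,2) entry by a phase u and the (2,1) entry
   by its conjugate. An edge vector orthogonal to 1 has the form
   (q^-2 g, b; c, -g); combined with rescaling by l, the phase u can be used to
   make b and c nonnegative with sum 2, i.e. b = 1 + beta and c = 1 - beta. The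
   remaining freedom in l is a sign if b, c <> 0, and an arbitrary phase if one
   of them vanishes; it is used up by normalising g.
   For two-dimensional S, the diagonal unitary that normalises the loopfree line
   (S + C1)^perp sends S to the loopfree complement of the normalised line. *)

From HB Require Import structures.
Require Import Defs.
From mathcomp Require Import all_boot all_order all_algebra.
From mathcomp Require Import complex.
From mathcomp Require Import all_classical all_reals all_analysis.
From mathcomp Require Import ring lra.

Set Implicit Arguments.
Unset Strict Implicit.
Unset Printing Implicit Defensive.

Import Order.TTheory GRing.Theory Num.Theory.
Local Open Scope classical_set_scope.
Local Open Scope ring_scope.
Local Open Scope complex_scope.

(** * Coordinates on [M2]: weight, KMS product and diagonal phases *)

Section Coordinates.
Variable R : realType.
Local Notation C := R[i].
Local Notation M2 := 'M[C]_2.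
Implicit Types (q t : R) (a b c d u k : C) (x y z : M2).

Lemma conj_ofreal t : Num.conj (t%:C : C) = t%:C.
Proof. exact: conjc_real. Qed.

Definition mx2 a b c d : M2 := mx_of_rows 2 [:: [:: a; b]; [:: c; d]].

Lemma mx2P x y :
  [/\ x 0 0 = y 0 0, x 0 1 = y 0 1, x 1 0 = y 1 0 & x 1 1 = y 1 1] -> x = y.
Proof.
have E (i : 'I_2) : i = 0 \/ i = 1.
  by case: i => [[|[|//]] ?]; [left | right]; apply: val_inj.
by case=> ? ? ? ?; apply/matrixP => i j; case: (E i) => ->; case: (E j) => ->.
Qed.

Lemma mx2E x : x = mx2 (x 0 0) (x 0 1) (x 1 0) (x 1 1).
Proof. by apply: mx2P; split; rewrite !mxE. Qed.

Lemma mx2_inj a b c d a' b' c' d' : mx2 a b c d = mx2 a' b' c' d' ->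
  [/\ a = a', b = b', c = c' & d = d'].
Proof.
move=> /matrixP E; split; [move: (E 0 0)|move: (E 0 1)|move: (E 1 0)|move: (E 1 1)];
  by rewrite !mxE.
Qed.

Lemma mx2D a b c d a' b' c' d' :
  mx2 a b c d + mx2 a' b' c' d' = mx2 (a + a') (b + b') (c + c') (d + d').
Proof. by apply: mx2P; split; rewrite !mxE. Qed.

Lemma mx2Z k a b c d : k *: mx2 a b c d = mx2 (k * a) (k * b) (k * c) (k * d).
Proof. by apply: mx2P; split; rewrite !mxE. Qed.

Lemma mx2M a b c d a' b' c' d' : mx2 a b c d *m mx2 a' b' c' d' =
  mx2 (a * a' + b * c') (a * b' + b * d') (c * a' + d * c') (c * b' + d * d').
Proof.
by apply: mx2P; split; rewrite !mxE !big_ord_recl big_ord0 !mxE /= addr0.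
Qed.

Lemma dagger_mx2 a b c d : dagger (mx2 a b c d) = mx2 a^*%R c^*%R b^*%R d^*%R.
Proof. by apply: mx2P; split; rewrite !mxE. Qed.

Lemma trace_mx2 a b c d : \tr (mx2 a b c d) = a + d.
Proof. by rewrite /mxtrace !big_ord_recl big_ord0 !mxE /= addr0. Qed.

Lemma mx2_1 : 1%:M = mx2 1 0 0 1.
Proof. by apply: mx2P; split; rewrite !mxE. Qed.

Lemma mx2_0 : 0 = mx2 0 0 0 0.
Proof. by apply: mx2P; split; rewrite !mxE. Qed.

Lemma rho_mx2 q : 0 < q -> rho q = (1 + q ^+ 2)%:C *: mx2 (q%:C ^- 2) 0 0 1.
Proof. by move=> q0; rewrite /rho fmorphV rmorphXn. Qed.

Lemma rho_pow_mx2 q t : 0 < q -> rho_pow q t =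
  ((1 + q ^+ 2) `^ t)%:C *: mx2 (q `^ (- 2 * t))%:C 0 0 1.
Proof.
move=> q0; have c0 : 0 <= 1 + q ^+ 2 by rewrite addr_ge0 ?sqr_ge0.
have -> : q `^ (- 2 * t) = (q ^- 2) `^ t.
  by rewrite powRrM -(powR_invn _ (ltW q0)).
apply: mx2P; split; rewrite !mxE /rho_eig //= ?mulr0n ?mulr0 //.
  by rewrite powRM ?rmorphM ?invr_ge0 ?sqr_ge0.
by rewrite !mulr1.
Qed.

Lemma psi_mx2 q a b c d : 0 < q ->
  psi q (mx2 a b c d) = (1 + q ^+ 2)%:C * (q%:C ^- 2 * a + d).
Proof.
move=> q0; rewrite /psi rho_mx2 // -scalemxAl mxtraceZ mx2M trace_mx2; ring.
Qed.

(** The [(i, j)] entry carries the weight [(rho_i rho_j)^(-1/2)], which gives the pattern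
    [q^2, q, q, 1] after the common factor is taken out. *)
Lemma kms_mx2 q a b c d a' b' c' d' : 0 < q ->
  kms q (mx2 a b c d) (mx2 a' b' c' d') = ((1 + q ^+ 2)^-1)%:C *
    (q%:C ^+ 2 * (a^* * a') + q%:C * (b^* * b') + q%:C * (c^* * c') + d^* * d').
Proof.
move=> q0; have c0 : 0 < 1 + q ^+ 2 by rewrite addr_gt0 ?exprn_gt0.
rewrite /kms rho_pow_mx2 // dagger_mx2.
have -> : - 2 * - (1 / 2) = 1 :> R by field.
rewrite powRr1 ?(ltW q0) //.
have -> : (1 + q ^+ 2)^-1 = (1 + q ^+ 2) `^ (- (1 / 2)) * (1 + q ^+ 2) `^ (- (1 / 2)).
  rewrite -powRD; last by rewrite (gt_eqF c0) implybT.
  by rewrite -powR_inv1 ?(ltW c0) //; congr (_ `^ _); field.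
rewrite rmorphM; set w := (_ `^ _)%:C.
rewrite -scalemxAr !mxtraceZ -scalemxAr -!scalemxAl mxtraceZ !mx2M trace_mx2.
ring.
Qed.

(** For [u] of modulus 1 this is conjugation by the unitary [diag(u, 1)]. *)
Definition phase u x : M2 := mx2 (x 0 0) (u * x 0 1) (u^* * x 1 0) (x 1 1).

Lemma phase_mx2 u a b c d : phase u (mx2 a b c d) = mx2 a (u * b) (u^* * c) d.
Proof. by apply: mx2P; split; rewrite !mxE. Qed.

Lemma phase_comp u v x : phase u (phase v x) = phase (u * v) x.
Proof. by rewrite (mx2E x) !phase_mx2 rmorphM !mulrA. Qed.

Lemma phase1 x : phase 1 x = x.
Proof. by rewrite (mx2E x) phase_mx2 rmorph1 !mul1r. Qed.

Lemma phase_linear u : linear (phase u).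
Proof.
move=> k x y; rewrite (mx2E x) (mx2E y) !phase_mx2 !mx2Z !mx2D phase_mx2.
by congr mx2; ring.
Qed.

Lemma phaseZ u k x : phase u (k *: x) = k *: phase u x.
Proof. by have := phase_linear u k x 0; rewrite mx2_0 phase_mx2 !mulr0 -mx2_0 !addr0. Qed.

Lemma phase_star_automorphism u : u * u^* = 1 -> star_automorphism (phase u).
Proof.
move=> u1; have u1' : u^* * u = 1 by rewrite mulrC.
split; first exact: phase_linear.
- by exists (phase u^*%R) => x; rewrite phase_comp ?u1 ?u1' phase1.
- move=> x y; rewrite (mx2E x) (mx2E y) phase_mx2 phase_mx2 !mx2M phase_mx2.
  by congr mx2; ring: u1.
- move=> x; rewrite (mx2E x) dagger_mx2 !phase_mx2 dagger_mx2.
  by rewrite !rmorphM /= conjCK.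
Qed.

Lemma psi_phase q u x : 0 < q -> psi q (phase u x) = psi q x.
Proof. by move=> q0; rewrite (mx2E x) phase_mx2 !psi_mx2. Qed.

Lemma kms_phase q u x y : 0 < q -> u * u^* = 1 ->
  kms q (phase u x) (phase u y) = kms q x y.
Proof.
move=> q0 u1; rewrite (mx2E x) (mx2E y) !phase_mx2 !kms_mx2 // !rmorphM /= conjCK.
by ring: u1.
Qed.

Lemma kmsC q x y : 0 < q -> kms q y x = (kms q x y)^*%R.
Proof.
move=> q0; rewrite (mx2E x) (mx2E y) !kms_mx2 //.
by rewrite !(rmorphM, rmorphD, rmorphXn) /= !conjCK !conj_ofreal; ring.
Qed.

End Coordinates.

(** * Automorphisms preserving [psi q], and isomorphism of lines *)

Section Isomorphisms.
Variable R : realType.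
Local Notation C := R[i].
Local Notation M2 := 'M[C]_2.
Variable q : R.
Hypothesis hq : 0 < q < 1.

Let q0 : 0 < q. Proof. by case/andP: hq. Qed.

Lemma ofreal_neq0 : q%:C != 0.
Proof. by rewrite fmorph_eq0 gt_eqF. Qed.

Lemma ofreal_sqr_neq1 : q%:C ^+ 2 != 1.
Proof.
rewrite -rmorphXn -(rmorph1 (real_complex R)) (inj_eq (@complexI R)).
by rewrite lt_eqF // exprn_ilt1 ?ltW //; case/andP: hq.
Qed.

(* A projection [e] with [psi q e = psi q e11] is [e11]: if its off-diagonal
   entries do not vanish then it has trace 1, and [q <> 1] determines its
   diagonal. *)
Lemma projection_psi (e : M2) : dagger e = e -> e *m e = e ->
  psi q e = psi q (mx2 1 0 0 0) -> e = mx2 1 0 0 0.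
Proof.
have s0 := ofreal_neq0; have s1 := ofreal_sqr_neq1.
rewrite (mx2E e); move: (e 0 0) (e 0 1) (e 1 0) (e 1 1) => a b c d.
rewrite dagger_mx2 mx2M !psi_mx2 // => /mx2_inj[_ cE bE _].
case/mx2_inj => aa ab ca dd /mulfI tr.
have {}tr : a + q%:C ^+ 2 * d = 1.
  have -> : a + q%:C ^+ 2 * d = q%:C ^+ 2 * (q%:C ^- 2 * a + d).
    by field.
  rewrite tr; first by field.
  by rewrite fmorph_eq0 gt_eqF // addr_gt0 ?exprn_gt0.
have [b0|b0] := eqVneq b 0.
  have c0 : c = 0 by rewrite -bE b0 rmorph0.
  move: aa dd; rewrite b0 c0 !mul0r addr0 add0r => aa dd.
  have : (1 - q%:C ^+ 2) * d = 0.
    have aE : a = 1 - q%:C ^+ 2 * d by rewrite -tr; ring.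
    move: aa; rewrite aE => aa.
    have : q%:C ^+ 2 * (d * (1 - q%:C ^+ 2)) = 0.
      (* With [a = 1 - q^2 d], subtracting the idempotent equation of [a] from [q^4] times that of
         [d] cancels the quadratic terms. *)
      transitivity (q%:C ^+ 4 * (d * d - d) -
        ((1 - q%:C ^+ 2 * d) * (1 - q%:C ^+ 2 * d) - (1 - q%:C ^+ 2 * d))).
        by ring.
      by rewrite aa dd !subrr mulr0 subrr.
    move/eqP; rewrite mulf_eq0 expf_eq0 (negPf s0) andbF /= => /eqP.
    by rewrite mulrC.
  move/eqP; rewrite mulf_eq0 subr_eq0 eq_sym (negPf s1) /= => /eqP d0.
  by congr mx2 => //; rewrite -tr d0 mulr0 addr0.
have ad : a + d = 1 by apply: (mulfI b0); rewrite mulr1 -[RHS]ab; ring.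
have : (1 - q%:C ^+ 2) * d = 0.
  have -> : (1 - q%:C ^+ 2) * d = (a + d) - (a + q%:C ^+ 2 * d) by ring.
  by rewrite ad tr subrr.
move/eqP; rewrite mulf_eq0 subr_eq0 eq_sym (negPf s1) /= => /eqP d0.
move/eqP: dd; rewrite d0 mulr0 addr0 mulf_eq0 (negPf b0) orbF => /eqP c0.
by move: b0; rewrite -cE c0 rmorph0 eqxx.
Qed.

(** Once [e11] is fixed, so is [e22 = 1 - e11]. Then [e12 = e11 e12 e22] forces [pi e12] to be a
    multiple [u] of [e12], the adjoint settles [e21], and [e12 e21 = e11] gives [|u| = 1]. *)
Lemma star_automorphism_phase (pi : M2 -> M2) : star_automorphism pi ->
  (forall x, psi q (pi x) = psi q x) ->
  exists2 u : C, u * u^* = 1 & pi =1 phase u.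
Proof.
case=> lin [g gK Kg] piM piD psiE.
have pi0 : pi 0 = 0.
  by have := lin (-1) 0 0; rewrite scaler0 addr0 scaleN1r addNr.
have e11 : pi (mx2 1 0 0 0) = mx2 1 0 0 0.
  apply: projection_psi; last exact: psiE.
    by rewrite -piD dagger_mx2 rmorph1 rmorph0.
  by rewrite -piM mx2M; congr (pi (mx2 _ _ _ _)); ring.
(* Unitality comes from surjectivity: [pi 1 = pi 1 * pi (g 1) = pi (g 1) = 1]. *)
have pi1 : pi 1%:M = 1%:M by rewrite -[LHS]mulmx1 -{2}(Kg 1%:M) -piM mul1mx Kg.
have e22 : pi (mx2 0 0 0 1) = mx2 0 0 0 1.
  have -> : mx2 0 0 0 1 = (-1 : C) *: mx2 1 0 0 0 + 1%:M.
    by rewrite mx2_1 mx2Z mx2D; congr mx2; ring.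
  by rewrite lin e11 pi1.
pose u := pi (mx2 0 1 0 0) 0 1.
have e12 : pi (mx2 0 1 0 0) = mx2 0 u 0 0.
  have -> : mx2 0 1 0 0 = mx2 1 0 0 0 *m mx2 0 1 0 0 *m mx2 0 0 0 1 :> M2.
    by rewrite !mx2M; congr mx2; ring.
  rewrite !piM e11 e22 (mx2E (pi (mx2 0 1 0 0))) !mx2M -/u.
  by congr mx2; ring.
have e21 : pi (mx2 0 0 1 0) = mx2 0 0 u^*%R 0.
  have -> : mx2 0 0 1 0 = dagger (mx2 0 1 0 0) :> M2.
    by rewrite dagger_mx2 rmorph1 rmorph0.
  by rewrite piD e12 dagger_mx2 rmorph0.
exists u.
  have : pi (mx2 0 1 0 0 *m mx2 0 0 1 0) = mx2 1 0 0 0.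
    by rewrite mx2M -e11; congr (pi (mx2 _ _ _ _)); ring.
  by rewrite piM e12 e21 mx2M => /mx2_inj[<- _ _ _]; ring.
move=> x; rewrite (mx2E x).
move: (x 0 0) (x 0 1) (x 1 0) (x 1 1) => a b c d; rewrite phase_mx2.
have -> : mx2 a b c d = a *: mx2 1 0 0 0 + (b *: mx2 0 1 0 0 +
    (c *: mx2 0 0 1 0 + (d *: mx2 0 0 0 1 + 0))).
  by rewrite !mx2Z addr0 !mx2D; congr mx2; ring.
rewrite !lin pi0 e11 e12 e21 e22 !mx2Z addr0 !mx2D.
by congr mx2; ring.
Qed.

Lemma isomorphicP (S1 S2 : {vspace M2}) :
  isomorphic q S1 S2 <->
  exists2 u : C, u * u^* = 1 & phase u @` [set` S1] = [set` S2].
Proof.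
split=> [[pi [piA piE im]]|[u u1 im]].
  have [u u1 piu] := star_automorphism_phase piA piE.
  by exists u => //; rewrite -im; apply: eq_imagel => x _; rewrite piu.
exists (phase u); split => //; first exact: phase_star_automorphism.
by move=> x; rewrite psi_phase.
Qed.

(** A line determines its generator only up to a scalar, hence the factor [l] besides the phase
    [u]. *)
Lemma isomorphic_lineP (x y : M2) : y != 0 ->
  isomorphic q <[x]> <[y]> <->
  exists u l : C, [/\ u * u^* = 1, l != 0 & y = l *: phase u x].
Proof.
move=> y0; rewrite isomorphicP; split=> [[u u1 im]|[u [l [u1 l0 ->]]]].
  have : [set` <[y]>%VS] y by exact: memv_line.
  rewrite -im => -[z /vlineP[k ->]]; rewrite phaseZ => yE.
  exists u, k; split => //; apply: contraNneq y0 => k0.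
  by rewrite -yE k0 scale0r.
exists u => //; apply/seteqP; split=> z /=.
  case=> ? /vlineP[k ->] <-; apply/vlineP; exists (k / l).
  by rewrite phaseZ scalerA divfK.
case/vlineP => k ->; exists ((k * l) *: x); first by rewrite memvZ ?memv_line.
by rewrite phaseZ scalerA.
Qed.

End Isomorphisms.

(** * Normalising the parameters [beta] and [gamma] *)

Section NormalForms.
Variable R : realType.
Local Notation C := R[i].
Local Notation M2 := 'M[C]_2.
Implicit Types (beta : R) (gamma g b c u v w l z : C).

(** This trades [acos] for linear conditions on real and imaginary parts. The origin is included
    because [carg 0 = 0]; the negative half-line is excluded because there [acos] takes the value
    [pi]. *)
Lemma carg_upperP z : 0 <= carg z < pi <->
  0 < complex.Im z \/ complex.Im z = 0 /\ 0 <= complex.Re z.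
Proof.
rewrite /carg; case: eqVneq => [->|z0] /=.
  by split=> _; [right | rewrite lexx pi_gt0].
case: z z0 => a b /=; rewrite eq_complex /= negb_and => ab0.
set n := Num.sqrt _.
have n2 : n ^+ 2 = a ^+ 2 + b ^+ 2 by rewrite sqr_sqrtr // addr_ge0 ?sqr_ge0.
have n0 : 0 < n.
  rewrite sqrtr_gt0 lt_def addr_ge0 ?sqr_ge0 // andbT paddr_eq0 ?sqr_ge0 //.
  by rewrite !sqrf_eq0 negb_and.
have an : - n <= a <= n by apply/andP; split; nra.
have r1 : -1 <= a / n <= 1.
  by rewrite ler_pdivlMr // ler_pdivrMr // mulN1r mul1r.
have [b0|b0] := leP 0 b; last first.
  have t0 : 0 < acos (a / n).
    rewrite acos_gt0 //; case/andP: r1 => -> _ /=.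
    by rewrite ltr_pdivrMr // mul1r; nra.
  split=> [/andP[]|]; first by rewrite oppr_ge0 leNgt t0.
  by case=> [?|[? _]]; exfalso; lra.
rewrite acos_ge0 //=; split=> [tpi|].
  have [b1|b1] := ltP 0 b; first by left.
  right; have bE : b = 0 by apply/le_anti; rewrite b0 b1.
  split=> //; rewrite leNgt; apply/negP => a0; move: tpi.
  have -> : a / n = -1.
    apply: (mulIf (lt0r_neq0 n0)); rewrite divfK ?lt0r_neq0 // mulN1r.
    by move: n2; rewrite bE; nra.
  by rewrite acosN1 ltxx.
move=> ab; apply: acos_ltpi; case/andP: r1 => _ ->; rewrite andbT.
by rewrite ltr_pdivlMr // mulN1r; case: ab => [|[bE a0]]; nra.
Qed.

Lemma polar z : exists v (r : R),
  [/\ v * v^* = 1, 0 <= r, v * z = r%:C & (r = 0 -> z = 0)].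
Proof.
have [->|z0] := eqVneq z 0.
  by exists 1, 0; split=> //; rewrite ?rmorph1 ?mulr1 ?mulr0.
have nz0 : `|z| != 0 by rewrite normr_eq0.
exists (`|z| / z), (complex.Re `|z|); split.
- by rewrite -normCK normrM normfV normr_id divff // expr1n.
- by rewrite normc_def /= sqrtr_ge0.
- by rewrite divfK // normc_def.
- rewrite normc_def /= => r0; apply/eqP; rewrite -normr_eq0 normc_def r0.
  by rewrite rmorph0.
Qed.

(** Once the phases are arranged, only a positive real factor [k] is missing. It makes the
    off-diagonal entries sum to 2 and does not move [w * g] out of the half plane or the
    half-line. *)
Lemma admissible_scale u w g b c (rb rc : R) :
  w * w^* = 1 -> u * u^* = 1 ->
  w * (u * b) = rb%:C -> w * (u^* * c) = rc%:C -> 0 <= rb -> 0 <= rc ->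
  0 < rb + rc -> (0 < rb -> 0 < rc -> 0 <= carg (w * g) < pi) ->
  (rb = 0 \/ rc = 0 -> 0 <= w * g) ->
  exists l beta, [/\ l != 0, admissible beta (l * g),
    l * (u * b) = (1 + beta)%:C & l * (u^* * c) = (1 - beta)%:C].
Proof.
move=> w1 u1 wb wc rb0 rc0 r0 up pos.
pose k := 2 / (rb + rc); have k0 : 0 < k by rewrite divr_gt0.
have kr : k * (rb + rc) = 2 by rewrite divfK ?gt_eqF.
exists (k%:C * w), (k * rb - 1).
have w0 : w != 0.
  by apply: contra_eq_neq w1 => ->; rewrite mul0r eq_sym oner_eq0.
split; first by rewrite mulf_neq0 // fmorph_eq0 gt_eqF.
- split; first by apply/andP; split; nra.
  + rewrite ltr_norml => /andP[b1 b2].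
    have /carg_upperP up' : 0 <= carg (w * g) < pi by apply: up; nra.
    apply/carg_upperP; move: up'; rewrite -mulrA.
    case: (w * g) => x y /=; rewrite !mul0r subr0 addr0.
    case=> [xp|[-> yp]]; [left | right]; first exact: mulr_gt0.
    by rewrite mulr0; split=> //; apply: mulr_ge0 => //; apply: ltW.
  + move=> b1; rewrite -mulrA mulr_ge0 ?ler0c ?(ltW k0) //; apply: pos.
    move/eqP: b1; rewrite eqr_norml => /andP[/orP[] /eqP bE _]; [right | left];
      by apply: (mulfI (lt0r_neq0 k0)); lra.
- by rewrite -mulrA wb -rmorphM; congr _%:C; ring.
- by rewrite -mulrA wc -rmorphM; congr _%:C; lra.
Qed.

(** The phases must satisfy [w * u = vb] and [w * u^* = vc], hence [w^2 = vb * vc]. If [b] and [c]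
    are both nonzero, [w] is fixed up to a sign, which is chosen to put [w * g] into the half plane.
    If one of them vanishes, its equation drops out and [w] can be chosen to make [w * g]
    nonnegative. *)
Lemma admissible_exists g b c : (b != 0) || (c != 0) ->
  exists u l beta, [/\ u * u^* = 1, l != 0, admissible beta (l * g),
    l * (u * b) = (1 + beta)%:C & l * (u^* * c) = (1 - beta)%:C].
Proof.
move=> bc0.
have [vb [rb [vb1 rb0 vbE rbz]]] := polar b.
have [vc [rc [vc1 rc0 vcE rcz]]] := polar c.
have [vg [rg [vg1 rg0 vgE _]]] := polar g.
have r0 : 0 < rb + rc.
  rewrite lt_def addr_ge0 // andbT paddr_eq0 // negb_and.
  by case/orP: bc0 => z0; apply/orP; [left | right];
    apply: contra_neq z0.
suff [w [u [w1 u1 wb wc wg]]] : exists w u, [/\ w * w^* = 1, u * u^* = 1,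
    w * (u * b) = rb%:C, w * (u^* * c) = rc%:C &
    (0 < rb -> 0 < rc -> 0 <= carg (w * g) < pi) /\
    (rb = 0 \/ rc = 0 -> 0 <= w * g)].
  have [l [beta [? ? ? ?]]] :=
    admissible_scale w1 u1 wb wc rb0 rc0 r0 wg.1 wg.2.
  by exists u, l, beta.
(* For [b = 0] only [w * u^* = vc] remains: take [w = vg] and solve for [u]. The case [c = 0] is
   symmetric. *)
have [rbE|rb_neq0] := eqVneq rb 0.
  exists vg, (vg * vc^*); split=> //.
  - by rewrite rmorphM /= conjCK; ring: vg1 vc1.
  - by rewrite (rbz rbE) rbE !mulr0.
  - by rewrite rmorphM /= conjCK -vcE; ring: vg1.
  - by split=> [|_]; rewrite ?rbE ?ltxx // vgE ler0c.
have [rcE|rc_neq0] := eqVneq rc 0.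
  exists vg, (vb * vg^*); split=> //.
  - by rewrite rmorphM /= conjCK; ring: vg1 vb1.
  - by rewrite -vbE; ring: vg1.
  - by rewrite (rcz rcE) rcE !mulr0.
  - by split=> [|_]; rewrite ?rcE ?ltxx // vgE ler0c.
have [w wE] : exists w, w * w = vb * vc.
  by exists (sqrtC (vb * vc)); rewrite -expr2 sqrtCK.
have w1 : w * w^* = 1.
  rewrite -normCK; have : `|w| ^+ 2 ^+ 2 = 1.
    rewrite -normrX (expr2 w) wE normrM exprMn !normCK; ring: vb1 vc1.
  by move/eqP; rewrite sqrp_eq1 ?exprn_ge0 // => /eqP.
(* Both square roots [v] of [vb * vc] solve the two equations, with [u = vb * v^*]. *)
have main v : v = w \/ v = - w -> [/\ v * v^* = 1,
    (vb * v^*) * (vb * v^*)^* = 1, v * (vb * v^* * b) = rb%:C &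
    v * ((vb * v^*)^* * c) = rc%:C].
  move=> vw; have v1 : v * v^* = 1.
    by case: vw => -> //; rewrite rmorphN /= mulrNN.
  have vE : v * v = vb * vc by case: vw => ->; rewrite ?mulrNN.
  split=> //.
  - by rewrite rmorphM /= conjCK; ring: v1 vb1.
  - by rewrite -vbE; ring: v1.
  - rewrite rmorphM /= conjCK -vcE.
    transitivity ((vb * vb^*) * vc * c); last by rewrite vb1 mul1r.
    by rewrite -[X in X * c]mulrAC -vE; ring.
have bad : rb = 0 \/ rc = 0 -> False.
  by case=> /eqP; rewrite ?(negPf rb_neq0) ?(negPf rc_neq0).
have [up|nup] := boolP (0 <= carg (w * g) < pi).
  exists w, (vb * w^*).
  by have [? ? ? ?] := main w (or_introl erefl); split=> //; split=> // /bad.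
exists (- w), (vb * (- w)^*).
have [? ? ? ?] := main (- w) (or_intror erefl); split=> //; split=> [_ _|/bad //].
apply/carg_upperP; rewrite mulNr.
have : ~ (0 <= carg (w * g) < pi) by apply/negP.
rewrite carg_upperP; case: (w * g) => x y /= nxy.
have [y0|y0|y0] := ltrgt0P y.
- by case: nxy; left.
- by left; rewrite oppr_gt0.
- right; rewrite y0 oppr0; split=> //; rewrite oppr_ge0 leNgt.
  by apply/negP => x0; apply: nxy; right; rewrite y0 ltW.
Qed.

(** Taking absolute values and adding, both off-diagonal sums equal 2, so [|l| = 1] and
    [beta' = beta]. If [|beta| = 1], the nonnegative [gamma] is determined by its modulus. Otherwise
    [l * u = l * u^* = 1], so [l^2 = 1] and only a sign is left. *)
Lemma admissible_unique beta gamma beta' gamma' u l :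
  admissible beta gamma -> admissible beta' gamma' -> u * u^* = 1 ->
  gamma' = l * gamma -> (1 + beta')%:C = l * (u * (1 + beta)%:C) ->
  (1 - beta')%:C = l * (u^* * (1 - beta)%:C) ->
  beta' = beta /\ gamma' = gamma.
Proof.
move=> [/andP[b1 b2] up pos] [/andP[b1' b2'] up' pos'] u1 gE bE cE.
have nu : `|u| = 1.
  by apply/eqP; rewrite -(@sqrp_eq1 _ `|u|) // normCK u1.
have norm_ofreal (t : R) : 0 <= t -> `|t%:C : C| = t%:C.
  by move=> t0; rewrite ger0_norm // ler0c.
have bE' : (1 + beta')%:C = `|l| * (1 + beta)%:C.
  by rewrite -norm_ofreal ?bE ?normrM ?nu ?mul1r ?norm_ofreal //; lra.
have cE' : (1 - beta')%:C = `|l| * (1 - beta)%:C.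
  by rewrite -norm_ofreal ?cE ?normrM ?norm_conjC ?nu ?mul1r ?norm_ofreal //; lra.
have nl : `|l| = 1.
  have : (1 + beta')%:C + (1 - beta')%:C = `|l| * ((1 + beta)%:C + (1 - beta)%:C).
    by rewrite mulrDr bE' cE'.
  have two (t : R) : (1 + t)%:C + (1 - t)%:C = 2 :> C.
    by rewrite -rmorphD -(rmorph_nat (real_complex R) 2); congr _%:C; ring.
  rewrite !two -{1}[2]mul1r => /mulIf -> //.
have betaE : beta' = beta.
  by move: bE'; rewrite nl mul1r => /complexI; apply: addrI.
split=> //; have [nb1|nb1] := eqVneq `|beta| 1.
  have g0 : 0 <= gamma by apply: pos.
  have g0' : 0 <= gamma' by apply: pos'; rewrite betaE.
  by rewrite -(ger0_norm g0') gE normrM nl mul1r ger0_norm.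
have nlt : `|beta| < 1 by rewrite lt_neqAle nb1 ler_norml b1.
have /andP[lt1 lt2] : -1 < beta < 1 by rewrite -ltr_norml.
move: bE cE; rewrite betaE !mulrA.
rewrite -{1}[(1 + beta)%:C]mul1r => /mulIf lu.
rewrite -{1}[(1 - beta)%:C]mul1r => /mulIf lu'.
have {}lu : l * u = 1.
  by rewrite lu // fmorph_eq0 gt_eqF //; lra.
have {}lu' : l * u^* = 1.
  by rewrite lu' // fmorph_eq0 gt_eqF //; lra.
have /eqP : l ^+ 2 = 1.
  transitivity ((l * u) * (l * u^*)); last by rewrite lu lu' mulr1.
  by ring: u1.
rewrite sqrf_eq1 => /orP[] /eqP lE; first by rewrite gE lE mul1r.
have /carg_upperP := up nlt.
have /carg_upperP : 0 <= carg gamma' < pi by apply: up'; rewrite betaE.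
(* For [l = -1], both [gamma] and [- gamma] lie in the half plane, which happens only for
   [gamma = 0]. *)
rewrite gE lE mulN1r; case: (gamma) => x y /=.
by case=> [?|[? ?]] [?|[? ?]]; apply/eqP; rewrite eq_complex /=; lra.
Qed.

End NormalForms.

(** * Positivity of the KMS product and adjacency matrices of lines *)

Section EdgeSpaces.
Variable R : realType.
Local Notation C := R[i].
Local Notation M2 := 'M[C]_2.
Variable q : R.
Hypothesis hq : 0 < q < 1.

Let q0 : 0 < q. Proof. by case/andP: hq. Qed.
Let w0 : 0 < 1 + q ^+ 2. Proof. by rewrite addr_gt0 ?exprn_gt0. Qed.
Let s0 := ofreal_neq0 hq.

Lemma kms_gt0 (x : M2) : x != 0 -> 0 < kms q x x.
Proof.
move=> x0; rewrite (mx2E x) kms_mx2 //.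
have sq (z : C) : z^* * z = `|z| ^+ 2 by rewrite normCK mulrC.
rewrite !sq mulr_gt0 ?ltcR ?invr_gt0 //.
have s_ge0 : 0 <= q%:C by rewrite lecR ltW.
rewrite lt_def !addr_ge0 ?mulr_ge0 ?exprn_ge0 // andbT.
apply: contraNneq x0 => /eqP.
rewrite !paddr_eq0 ?addr_ge0 ?mulr_ge0 ?exprn_ge0 //.
rewrite !mulf_eq0 !normr_eq0 !(negPf s0) !orbb /=.
case/andP=> /andP[/andP[/eqP aE /eqP bE] /eqP cE] /eqP dE.
by apply/eqP; rewrite (mx2E x) aE bE cE dE -mx2_0.
Qed.

Lemma kmsZr (k : C) (x y : M2) : kms q x (k *: y) = k * kms q x y.
Proof. by rewrite /kms -scalemxAr -scalemxAl mxtraceZ. Qed.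

Lemma kmsZl (k : C) (x y : M2) : kms q (k *: x) y = k^* * kms q x y.
Proof. by rewrite kmsC // kmsZr rmorphM /= -kmsC. Qed.

(** This is [rho^(-1/4) x rho^(1/4)] in coordinates; the scalar factors of the two powers cancel. *)
Definition twist (x : M2) : M2 :=
  mx2 (x 0 0) ((q `^ (1 / 2))%:C * x 0 1) ((q `^ (- (1 / 2)))%:C * x 1 0) (x 1 1).

Lemma adjacency_map_seq1 (x y : M2) :
  adjacency_map q [:: x] y = twist x *m y *m dagger (twist x).
Proof.
have h1 : (q `^ (1 / 2))%:C * (q `^ (- (1 / 2)))%:C = 1 :> C.
  by rewrite -rmorphM -powRD ?subrr ?powRr0 // (gt_eqF q0) implybT.
have v1 : ((1 + q ^+ 2) `^ (- (1 / 4)))%:C * ((1 + q ^+ 2) `^ (1 / 4))%:C = 1 :> C.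
  by rewrite -rmorphM -powRD ?addNr ?powRr0 // (gt_eqF w0) implybT.
rewrite /adjacency_map big_seq1 !rho_pow_mx2 //.
have -> : - 2 * - (1 / 4) = 1 / 2 :> R by field.
have -> : - 2 * (1 / 4) = - (1 / 2) :> R by field.
rewrite (mx2E x) (mx2E y) !dagger_mx2 /twist !mxE /=.
move: v1 h1.
set v := (_ `^ _)%:C; set v' := (_ `^ _)%:C.
set h := (_ `^ _)%:C; set h' := (_ `^ _)%:C => v1 h1.
rewrite !rmorphM /= !conj_ofreal -/h -/h'.
rewrite !mx2Z !mx2M; congr mx2; ring: v1 h1.
Qed.

(** The Kronecker product of [x] with its entrywise conjugate. *)
Definition kron_conj (x : M2) : 'M[C]_4 :=
  let: (a, b, c, d) := (x 0 0, x 0 1, x 1 0, x 1 1) in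
  mx_of_rows 4
    [:: [:: a * a^*; a * b^*; b * a^*; b * b^*];
        [:: a * c^*; a * d^*; b * c^*; b * d^*];
        [:: c * a^*; c * b^*; d * a^*; d * b^*];
        [:: c * c^*; c * d^*; d * c^*; d * d^*]].

Lemma matrix_of_map_conjugation (x : M2) :
  matrix_of_map (fun y => x *m y *m dagger x) = kron_conj x.
Proof.
have inord0 : inord 0 = 0 :> 'I_2 by apply: val_inj; rewrite /= inordK.
have inord1 : inord 1 = 1 :> 'I_2 by apply: val_inj; rewrite /= inordK.
have e00 : delta_mx 0 0 = mx2 1 0 0 0 :> M2.
  by apply: mx2P; split; rewrite !mxE.
have e01 : delta_mx 0 1 = mx2 0 1 0 0 :> M2.
  by apply: mx2P; split; rewrite !mxE.
have e10 : delta_mx 1 0 = mx2 0 0 1 0 :> M2.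
  by apply: mx2P; split; rewrite !mxE.
have e11 : delta_mx 1 1 = mx2 0 0 0 1 :> M2.
  by apply: mx2P; split; rewrite !mxE.
rewrite (mx2E x); move: (x 0 0) (x 0 1) (x 1 0) (x 1 1) => a b c d.
apply/matrixP; do 2!case=> [[|[|[|[|//]]]] ?];
  rewrite /matrix_of_map /kron_conj [LHS]mxE /= ?inord0 ?inord1 ?e00 ?e01 ?e10 ?e11
    dagger_mx2 !mx2M !mxE /=; ring.
Qed.

Lemma kron_conjZ (k : C) (x : M2) : kron_conj (k *: x) = (k * k^*) *: kron_conj x.
Proof.
apply/matrixP; do 2!case=> [[|[|[|[|//]]]] ?];
  rewrite [RHS]mxE /kron_conj /mx_of_rows /= !mxE /= !rmorphM /=; ring.
Qed.

Lemma twistZ (k : C) (x : M2) : twist (k *: x) = k *: twist x.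
Proof. by rewrite /twist mx2Z !mxE; congr mx2; ring. Qed.

(** An orthonormal basis of the line is a single vector [k *: x] with [|k|^2 * kms q x x = 1]. The
    Kronecker product depends on [k] only through [|k|^2], so the choice of [k] does not matter. *)
Lemma quantum_adjacency_line (x : M2) : x != 0 ->
  is_quantum_adjacency_matrix q <[x]> ((kms q x x)^-1 *: kron_conj (twist x)).
Proof.
move=> x0; have n0 := kms_gt0 x0; split.
  pose k := (sqrtC (kms q x x))^-1.
  have k_ge0 : 0 <= k by rewrite invr_ge0 sqrtC_ge0 ltW.
  have k0 : k != 0 by rewrite invr_eq0 sqrtC_eq0 gt_eqF.
  exists [:: k *: x]; split.
    rewrite basisEdim /= dim_vline x0 andbT -memvE span_seq1.
    by apply/vlineP; exists k^-1; rewrite scalerA mulVf ?scale1r.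
  case=> [|//] [|//] _ _ /=; rewrite kmsZl kmsZr (CrealP (ger0_real k_ge0)).
  by rewrite mulrA -expr2 exprVn sqrtCK mulVf ?gt_eqF.
move=> X [bX oX].
have szX : size X = 1%N.
  by have /eqP := size_basis (X := in_tuple X) bX; rewrite dim_vline x0 => /eqP <-.
case: X szX bX oX => [|y [|//]] // _ bX oX.
have /vlineP[k yE] : y \in <[x]>%VS by rewrite (basis_mem bX) ?mem_head.
have := oX 0%N 0%N isT isT; rewrite /= yE kmsZl kmsZr mulrA => kk.
have -> : adjacency_map q [:: k *: x] =
    fun z => twist (k *: x) *m z *m dagger (twist (k *: x)).
  by apply/funext => z; exact: adjacency_map_seq1.
rewrite matrix_of_map_conjugation twistZ kron_conjZ; congr (_ *: _).
by apply: (mulIf (lt0r_neq0 n0)); rewrite mulVf ?gt_eqF // (mulrC k) kk.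
Qed.

Lemma edge_vector_mx2 (G : one_edge_graph R) : edge_vector q G =
  match G with
  | G1B => mx2 (q%:C ^- 2) 0 0 (-1)
  | G1C beta gamma =>
      mx2 (q%:C ^- 2 * gamma) (1 + beta)%:C (1 - beta)%:C (- gamma)
  end.
Proof. by case: G => *; rewrite /= fmorphV rmorphXn. Qed.

Lemma edge_vector_neq0 (G : one_edge_graph R) : edge_vector q G != 0.
Proof.
apply/eqP; rewrite edge_vector_mx2 mx2_0.
case: G => [|beta gamma] /mx2_inj[].
  by move/eqP; rewrite invr_eq0 expf_eq0 (negPf s0).
by move=> _ [] ? [] ? _; lra.
Qed.

Lemma kms_undirected_line (x : M2) : dagger x = x -> kms_undirected <[x]>.
Proof.
move=> xE; have dZ (k : C) : dagger (k *: x) = k^* *: x.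
  rewrite -[in RHS]xE (mx2E x) mx2Z !dagger_mx2 mx2Z.
  by congr mx2; rewrite rmorphM.
apply/seteqP; split=> z /=.
  case/vlineP=> k ->; exists (k^* *: x); first by rewrite memvZ ?memv_line.
  by rewrite dZ conjCK.
by case=> ? /vlineP[k ->] <-; rewrite dZ memvZ ?memv_line.
Qed.

Lemma rho_conjugation (a b c d : C) :
  rho q *m mx2 a b c d *m invmx (rho q) =
  mx2 a (q%:C ^- 2 * b) (q%:C ^+ 2 * c) d.
Proof.
have : (1 + q ^+ 2)%:C != 0 :> C by rewrite fmorph_eq0 gt_eqF.
rewrite rho_mx2 //; move: (1 + q ^+ 2)%:C => w w_neq0.
pose N : M2 := w^-1 *: mx2 (q%:C ^+ 2) 0 0 1.
have rN : (w *: mx2 (q%:C ^- 2) 0 0 1) *m N = 1%:M.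
  rewrite /N mx2_1 !mx2Z mx2M.
  by congr mx2; field; rewrite ?s0 ?w_neq0.
have [rU _] := mulmx1_unit rN.
have -> : invmx (w *: mx2 (q%:C ^- 2) 0 0 1) = N.
  by rewrite -(mulKmx rU N) rN mulmx1.
rewrite /N !mx2Z !mx2M.
by congr mx2; field; rewrite ?s0 ?w_neq0.
Qed.

Lemma A1B_adjacency :
  is_quantum_adjacency_matrix q (edge_space q G1B) (A1B q).
Proof.
have := quantum_adjacency_line (edge_vector_neq0 G1B).
rewrite /edge_space edge_vector_mx2; congr is_quantum_adjacency_matrix.
have wC0 : 1 + q%:C ^+ 2 != 0 :> C.
  by rewrite -rmorphXn -(rmorph1 (real_complex R)) -rmorphD fmorph_eq0 gt_eqF.
rewrite kms_mx2 // /A1B; apply/matrixP.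
do 2!case=> [[|[|[|[|//]]]] ?]; rewrite /kron_conj /twist !mxE /=;
  rewrite ?(rmorphN, fmorphV, rmorphXn, rmorphD, rmorph1, rmorph0) /=;
  rewrite ?conj_ofreal; field; rewrite ?s0 ?wC0 //.
Qed.

Lemma A1C_adjacency (beta : R) (gamma : C) :
  is_quantum_adjacency_matrix q (edge_space q (G1C beta gamma))
    (A1C q beta gamma).
Proof.
have := quantum_adjacency_line (edge_vector_neq0 (G1C beta gamma)).
have n0 := kms_gt0 (edge_vector_neq0 (G1C beta gamma)).
rewrite /edge_space edge_vector_mx2 in n0 *.
congr is_quantum_adjacency_matrix.
(* The constant [c] is the squared KMS norm of the edge vector. *)
rewrite /A1C; congr (_^-1 *: _).
  rewrite kms_mx2 // normCK.
  rewrite !(rmorphM, rmorphN, fmorphV, rmorphXn, rmorphD, rmorphB, rmorph1,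
    rmorph_nat) /=.
  have ww : 1 + q%:C * q%:C != 0 :> C.
    by rewrite -rmorphM -(rmorph1 (real_complex R)) -rmorphD fmorph_eq0 gt_eqF.
  by rewrite ?conj_ofreal; field; apply/andP.
(* In terms of [h], the square root of [q], all real powers become integer powers, within reach of
   [field]. *)
pose h : C := (q `^ (1 / 2))%:C.
have h0 : h != 0 by rewrite fmorph_eq0 gt_eqF ?powR_gt0.
have qh : q%:C = h ^+ 2.
  have e : 1 / 2 * 2%:R = 1 :> R by field.
  by rewrite -rmorphXn -powR_mulrn ?powR_ge0 // -powRrM e powRr1 ?ltW.
have hE n t : t = - (1 / 2) * n%:R -> (q `^ t)%:C = h ^- n.
  move=> ->; rewrite powRrM powR_mulrn ?powR_ge0 // powRN.
  by rewrite rmorphXn fmorphV exprVn.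
have h1 : (q `^ (- (1 / 2)))%:C = h ^- 1 by apply: hE; field.
have h3 : (q `^ (- (3 / 2)))%:C = h ^- 3 by apply: hE; field.
have h5 : (q `^ (- (5 / 2)))%:C = h ^- 5 by apply: hE; field.
have conjE : conjc gamma = Num.conj gamma by [].
rewrite h3 h5 -/h normCK conjE; apply/matrixP.
do 2!case=> [[|[|[|[|//]]]] ?]; rewrite /kron_conj /twist !mxE /= ?h1 -/h;
  rewrite !(rmorphM, rmorphN, fmorphV, rmorphXn, rmorphD, rmorphB, rmorph1,
    rmorph_nat) /=;
  rewrite ?conj_ofreal ?qh; field; rewrite ?h0 //.
Qed.

End EdgeSpaces.

(** * Orthogonal complements as kernels *)

Section Classification.
Variable R : realType.
Local Notation C := R[i].
Local Notation M2 := 'M[C]_2.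

HB.instance Definition _ (u : C) :=
  GRing.isLinear.Build C M2 M2 *:%R (phase u) (phase_linear u).

(** Its kernel is the KMS-orthogonal complement of the tuple, so complements can be handled by
    rank-nullity. *)
Definition kms_row (q : R) n (X : n.-tuple M2) (y : M2) : 'rV[C]_n :=
  \row_i kms q X`_i y.

Lemma kms_row_linear q n (X : n.-tuple M2) : linear (kms_row q X).
Proof.
move=> k y z; apply/rowP => i; rewrite !mxE /kms.
by rewrite mulmxDr mulmxDl mxtraceD -scalemxAr -scalemxAl mxtraceZ.
Qed.

HB.instance Definition _ q n (X : n.-tuple M2) :=
  GRing.isLinear.Build C M2 'rV[C]_n *:%R (kms_row q X) (kms_row_linear q X).

Variable q : R.
Hypothesis hq : 0 < q < 1.

Let q0 : 0 < q. Proof. by case/andP: hq. Qed.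
Let s0 := ofreal_neq0 hq.

Lemma dim_lker_kms_row n (X : n.-tuple M2) :
  (\dim (lker (linfun (kms_row q X))) + \dim (limg (linfun (kms_row q X))) = 4)%N.
Proof.
by have := limg_ker_dim (linfun (kms_row q X)) fullv; rewrite capfv dimvf dim_matrix.
Qed.

Lemma kms_perp_lineP (x y : M2) : kms_perp q <[x]> y <-> kms q x y = 0.
Proof.
split=> [|xy z /vlineP[k ->]]; first by apply; exact: memv_line.
by rewrite kmsZl // xy mulr0.
Qed.

(** The functional [kms q x] is nonzero at [x] by positivity, so its kernel has dimension at most 3.
    A three-dimensional subspace of the kernel therefore fills it. *)
Lemma kms_perp_line (x : M2) (U : {vspace M2}) : x != 0 -> \dim U = 3%N ->
  (forall y, y \in U -> kms q x y = 0) -> kms_perp q <[x]> = [set` U].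
Proof.
move=> x0 dU Ux; pose f := linfun (kms_row q [tuple x]).
have kerE y : (y \in lker f) = (kms q x y == 0).
  rewrite memv_ker lfunE; apply/eqP/eqP => [/rowP/(_ 0)|xy].
    by rewrite !mxE.
  by apply/rowP => i; rewrite !mxE ord1.
have dim_f : (0 < \dim (limg f))%N.
  rewrite lt0n dimv_eq0; apply: contraTneq (kms_gt0 hq x0) => f0.
  have : f x \in limg f by rewrite memv_img ?memvf.
  rewrite f0 memv0 lfunE => /eqP/rowP/(_ 0); rewrite !mxE /= => ->.
  by rewrite ltxx.
have UK : U = lker f.
  apply/eqP; rewrite eqEdim dU; apply/andP; split.
    by apply/subvP => y yU; rewrite kerE Ux.
  have dim4 := dim_lker_kms_row [tuple x].
  by rewrite -ltnS -[X in (_ < X)%N]dim4 -[X in (X < _)%N]addn0 ltn_add2l.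
apply/seteqP; split=> y /=; rewrite UK kerE.
  by move/kms_perp_lineP => ->.
by move/eqP/kms_perp_lineP.
Qed.

(** Pairing with a basis of [W] maps a space of dimension 4 to one of dimension less than 4, so its
    kernel contains a nonzero [z]. *)
Lemma kms_perp_nonzero (W : {vspace M2}) : (\dim W < 4)%N ->
  exists2 z : M2, z != 0 & forall x, x \in W -> kms q x z = 0.
Proof.
move=> dW; pose f := linfun (kms_row q (vbasis W)).
exists (vpick (lker f)).
  rewrite vpick0 -dimv_eq0 -lt0n.
  have := dimvS (subvf (limg f)); rewrite dimvf dim_matrix mul1r => limgW.
  rewrite -(ltn_add2r (\dim (limg f))) add0n dim_lker_kms_row.
  exact: leq_ltn_trans limgW dW.
set z := vpick _; have := memv_pick (lker f).
rewrite memv_ker lfunE => /eqP/rowP fz x xW; rewrite kmsC //.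
(* The form is linear only in its second argument, so the roles of [x] and [z] are swapped before
   expanding [x] in the basis. *)
suff /rowP/(_ 0) : kms_row q [tuple z] x = 0 by rewrite !mxE /= => ->; rewrite rmorph0.
rewrite (coord_vbasis xW) linear_sum big1 // => i _; rewrite linearZ /=.
apply/rowP => j; rewrite !mxE ord1 /= kmsC //.
by have := fz i; rewrite !mxE => ->; rewrite rmorph0 mulr0.
Qed.

(** * Undirectedness of the listed graphs *)

Lemma kms_gns_undirected_G1B : gns_undirected q (edge_space q (@G1B R)).
Proof.
rewrite /edge_space edge_vector_mx2 //; split.
  apply: kms_undirected_line; rewrite dagger_mx2.
  by congr mx2; rewrite ?rmorph0 // ?rmorphN1 // -rmorphXn -fmorphV conj_ofreal.
apply/seteqP; split=> y /=.
  case=> ? /vlineP[k ->] <-; rewrite mx2Z rho_conjugation // !mulr0.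
  by apply/vlineP; exists k; rewrite mx2Z !mulr0.
move=> yU; exists y => //; case/vlineP: yU => k ->.
by rewrite mx2Z rho_conjugation // !mulr0.
Qed.

(** The edge vector is the adjoint of some multiple [k] of itself. The adjoint swaps the
    off-diagonal entries, whose sum is 2 either way, so [k = 1] and the vector is self-adjoint. *)
Lemma kms_undirected_G1C (beta : R) (gamma : C) :
  kms_undirected (edge_space q (G1C beta gamma)) -> beta = 0 /\ gamma^*%R = gamma.
Proof.
rewrite /edge_space edge_vector_mx2 // => undir.
have : [set` <[mx2 (q%:C ^- 2 * gamma) (1 + beta)%:C (1 - beta)%:C (- gamma)]>%VS]
    (mx2 (q%:C ^- 2 * gamma) (1 + beta)%:C (1 - beta)%:C (- gamma)).
  exact: memv_line.
rewrite {1}undir => -[? /vlineP[k ->]].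
rewrite mx2Z dagger_mx2 !rmorphM !rmorphN /= !conj_ofreal.
case/mx2_inj => _ bE cE; rewrite mulrN => /oppr_inj gE.
have k1 : k^*%R = 1.
  have : k^* * (1 - beta)%:C + k^* * (1 + beta)%:C = 2.
    by rewrite bE cE -rmorphD -(rmorph_nat (real_complex R) 2); congr _%:C; ring.
  rewrite -mulrDr -rmorphD.
  have -> : 1 - beta + (1 + beta) = 2 by ring.
  rewrite rmorph_nat -{2}[2]mul1r => /mulIf; apply.
  by rewrite pnatr_eq0.
move: bE gE; rewrite k1 mul1r => /complexI bE gE.
by split; [lra | rewrite -[RHS]gE mul1r].
Qed.

(** For [beta = 0] both off-diagonal entries are 1, while conjugation by [rho q] multiplies them by
    [q^-2] and [q^2]. Invariance of the line would make these factors equal, that is [q^4 = 1]. *)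
Lemma not_gns_undirected_G1C (beta : R) (gamma : C) :
  ~ gns_undirected q (edge_space q (G1C beta gamma)).
Proof.
case=> /kms_undirected_G1C[-> _]; rewrite /edge_space edge_vector_mx2 //.
rewrite addr0 subr0 rmorph1; set x := mx2 _ _ _ _ => inv.
have : [set` <[x]>%VS] (rho q *m x *m invmx (rho q)).
  by rewrite -inv; exists x => //; exact: memv_line.
case/vlineP=> k; rewrite rho_conjugation // mx2Z => /mx2_inj[_ kb kc _].
have : q%:C ^+ 2 * q%:C ^+ 2 = 1.
  have sE : q%:C ^+ 2 = q%:C ^- 2 by rewrite -[LHS]mulr1 kc -kb mulr1.
  by rewrite {2}sE mulfV ?expf_neq0.
rewrite -!rmorphXn -rmorphM -(rmorph1 (real_complex R)) => /complexI/eqP.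
case/andP: hq => _ q1; rewrite -exprD lt_eqF //.
by rewrite exprn_ilt1 // ltW.
Qed.

Lemma kms_undirected_G1C_iff (beta : R) (gamma : C) : admissible beta gamma ->
  kms_undirected (edge_space q (G1C beta gamma)) <-> beta = 0 /\ 0 <= gamma.
Proof.
move=> adm; split=> [/kms_undirected_G1C[b0 gE]|[-> g0]].
  split=> //; case: adm => _ + _; rewrite b0 normr0 => /(_ ltr01)/carg_upperP.
  case: gamma gE => x y /eqP; rewrite eq_complex lecE /= => /andP[_ /eqP yE].
  by case=> [?|[-> ->]]; [lra | rewrite eqxx].
apply: kms_undirected_line; rewrite edge_vector_mx2 // dagger_mx2.
rewrite addr0 subr0 rmorphM rmorphN /= (CrealP (ger0_real g0)) !conj_ofreal.
by rewrite -rmorphXn -fmorphV conj_ofreal.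
Qed.

(** * Normal forms of loopfree vectors and the classification *)

Lemma loopfree_vectorP (x : M2) : kms q 1%:M x = 0 ->
  exists g b c : C, x = mx2 (q%:C ^- 2 * g) b c (- g).
Proof.
rewrite (mx2E x) mx2_1 kms_mx2 //.
move: (x 0 0) (x 0 1) (x 1 0) (x 1 1) => a b c d.
move/eqP; rewrite mulf_eq0 fmorph_eq0 invr_eq0 gt_eqF ?addr_gt0 ?exprn_gt0 //=.
rewrite rmorph1 rmorph0 !mul0r !mulr0 !addr0 !mul1r => /eqP h.
(* Orthogonality to the unit reads [q^2 a + d = 0]. *)
exists (- d), b, c; rewrite opprK; congr mx2.
by have -> : - d = q%:C ^+ 2 * a by [rewrite -[LHS]add0r -h; ring]; field.
Qed.

Lemma normal_form_exists (x : M2) : x != 0 -> kms q 1%:M x = 0 ->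
  exists (G : one_edge_graph R) (u l : C),
    [/\ listed G, u * u^* = 1, l != 0 & edge_vector q G = l *: phase u x].
Proof.
move=> x0 /loopfree_vectorP[g [b [c xE]]].
have [bc|] := boolP ((b != 0) || (c != 0)).
  have [u [l [beta [u1 l0 adm bE cE]]]] := admissible_exists g bc.
  exists (G1C beta (l * g)), u, l; split=> //.
  rewrite edge_vector_mx2 // xE phase_mx2 mx2Z -bE -cE.
  by congr mx2; ring.
rewrite negb_or !negbK => /andP[/eqP b0 /eqP c0].
have g0 : g != 0.
  by apply: contraNneq x0 => g0; rewrite xE b0 c0 g0 oppr0 mulr0 -mx2_0.
exists G1B, 1, g^-1; split=> //; first by rewrite rmorph1 mulr1.
  by rewrite invr_eq0.
rewrite phase1 edge_vector_mx2 // xE b0 c0 mx2Z.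
by congr mx2; rewrite ?mulr0 //; field; rewrite ?s0 ?g0.
Qed.

(** Phases and nonzero scalars preserve the vanishing of each off-diagonal entry. Since [1 + beta]
    and [1 - beta] never vanish together, the two families cannot meet. *)
Lemma normal_form_unique (G G' : one_edge_graph R) (u l : C) :
  listed G -> listed G' -> u * u^* = 1 -> l != 0 ->
  edge_vector q G' = l *: phase u (edge_vector q G) -> G = G'.
Proof.
move=> LG LG' u1 l0; rewrite !edge_vector_mx2 //.
case: G G' LG LG' => [|beta gamma] [|beta' gamma'] //= adm adm';
  rewrite phase_mx2 mx2Z => /mx2_inj[_].
- rewrite !mulr0 => /eqP; rewrite fmorph_eq0 => /eqP bE /eqP.
  by rewrite fmorph_eq0 => /eqP cE _; exfalso; clear -bE cE; lra.
- have u0 : u != 0.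
    by apply: contra_eq_neq u1 => ->; rewrite mul0r eq_sym oner_eq0.
  move/esym/eqP; rewrite !mulf_eq0 (negPf l0) (negPf u0) fmorph_eq0 /= => /eqP bE.
  move/esym/eqP; rewrite !mulf_eq0 (negPf l0) conjC_eq0 (negPf u0) fmorph_eq0 /=.
  by move=> /eqP cE _; exfalso; clear -bE cE; lra.
- move=> bE cE; rewrite mulrN => /oppr_inj gE.
  by have [-> ->] := admissible_unique adm adm' u1 gE bE cE.
Qed.

Lemma one_edge_classification (S : {vspace M2}) : loopfree q S -> \dim S = 1%N ->
  exists! G : one_edge_graph R, listed G /\ isomorphic q S (edge_space q G).
Proof.
move=> hS dS; pose x := vpick S.
have x0 : x != 0 by rewrite vpick0 -dimv_eq0 dS.
have SE : S = <[x]>%VS.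
  apply/esym/eqP; rewrite eqEdim dS dim_vline x0 andbT -memvE; exact: memv_pick.
have [G [u [l [LG u1 l0 GE]]]] := normal_form_exists x0 (hS _ (memv_pick S)).
exists G; split.
  split=> //; rewrite SE; apply/(isomorphic_lineP hq x (edge_vector_neq0 hq G)).
  by exists u, l.
move=> G' [LG']; rewrite {1}SE.
move/(isomorphic_lineP hq x (edge_vector_neq0 hq G')) => [u' [l' [u1' l0' GE']]].
have u1c : u^* * u = 1 by rewrite mulrC.
(* Going back from [G] to [x] and on to [G'] composes the inverse of the first normalisation with
   the second. *)
apply: (normal_form_unique (u := u' * u^*) (l := l' / l)) => //.
- by rewrite rmorphM /= conjCK; ring: u1 u1'.
- by rewrite mulf_neq0 ?invr_eq0.
rewrite GE' GE phaseZ scalerA divfK // phase_comp -mulrA u1c mulr1 //.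
Qed.

Lemma two_edge_classification (S : {vspace M2}) : loopfree q S -> \dim S = 2%N ->
  exists G : one_edge_graph R, exists S' : {vspace M2},
    [/\ listed G, is_loopfree_complement q (edge_space q G) S' & isomorphic q S S'].
Proof.
move=> hS dS; have one0 : 1%:M != 0 :> M2 by rewrite mx2_1 mx2_0; apply/eqP =>
  /mx2_inj[/eqP]; rewrite oner_eq0.
have dW : (\dim (S + <[1%:M : M2]>) < 4)%N.
  have := dimv_add_leqif S <[1%:M : M2]>; rewrite dS dim_vline one0.
  by case=> le_dim _; exact: leq_ltn_trans le_dim _.
have [z z0 zW] := kms_perp_nonzero dW.
have zS x : x \in S -> kms q x z = 0.
  by move=> xS; apply/zW/(subvP (addvSl S _)).
have z1 : kms q 1%:M z = 0.
  by apply/zW/(subvP (addvSr S _)); exact: memv_line.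
have [G [u [l [LG u1 l0 GE]]]] := normal_form_exists z0 z1.
pose f : 'End(M2) := linfun (phase u).
have fE x : f x = phase u x by rewrite lfunE.
have phase_one : phase u 1%:M = 1%:M by rewrite mx2_1 phase_mx2 !mulr0.
have S'1 x : x \in (f @: S)%VS -> kms q 1%:M x = 0.
  case/memv_imgP=> y yS ->; rewrite fE -phase_one kms_phase //; exact: hS.
have cap0 : (f @: S :&: <[1%:M]>)%VS = 0%VS.
  apply/eqP; rewrite -subv0; apply/subvP => x /memv_capP[/S'1 x1 /vlineP[k xE]].
  move/eqP: x1; rewrite xE kmsZr mulf_eq0 (gt_eqF (kms_gt0 hq one0)) orbF.
  by move/eqP => ->; rewrite scale0r mem0v.
exists G, (f @: S)%VS; split=> //.
  split=> //; last exact/directv_addP.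
  (* The sum of [f @: S] and the unit line has dimension 3, as [phase u] is injective. It is
     orthogonal to the edge vector, since [phase u] preserves [kms q] and fixes the unit. *)
  apply: kms_perp_line; first exact: edge_vector_neq0.
    rewrite dimv_disjoint_sum // dim_vline one0 limg_dim_eq ?dS //.
    apply/eqP; rewrite -subv0; apply/subvP => x /memv_capP[_].
    rewrite memv_ker fE => /eqP fx; rewrite memv0.
    have uc : u^* * u = 1 by rewrite mulrC.
    rewrite -(phase1 x) -uc -phase_comp fx mx2_0 phase_mx2 !mulr0 -mx2_0 //.
  move=> y /memv_addP[y1 /memv_imgP[v vS ->] [? /vlineP[k ->] ->]].
  rewrite GE kmsZl // /kms mulmxDr mulmxDl mxtraceD -!/(kms _ _ _) fE kms_phase //.
  rewrite kmsC // zS // rmorph0 add0r kmsZr -phase_one kms_phase // kmsC // z1.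
  by rewrite rmorph0 !mulr0.
apply/isomorphicP => //; exists u => //; apply/seteqP; split=> y /=.
  by case=> x xS <-; rewrite -fE memv_img.
by case/memv_imgP=> x xS ->; exists x; rewrite ?fE.
Qed.

End Classification.

Theorem theorem1p2 (R : realType) (q : R) (hq : 0 < q < 1)
    (S : {vspace 'M[R[i]]_2}) (hS : loopfree q S) :
  [/\
    [/\ \dim S = 1%N ->
          exists! G : one_edge_graph R, listed G /\ isomorphic q S (edge_space q G),
        [/\ is_quantum_adjacency_matrix q (edge_space q G1B) (A1B q),
            gns_undirected q (edge_space q G1B)
          & kms_undirected (edge_space q G1B)]
      & forall (beta : R) (gamma : R[i]), admissible beta gamma ->
        [/\ is_quantum_adjacency_matrix q (edge_space q (G1C beta gamma))
              (A1C q beta gamma),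
            ~ gns_undirected q (edge_space q (G1C beta gamma))
          & kms_undirected (edge_space q (G1C beta gamma)) <->
              (beta = 0 /\ 0 <= gamma)]],
    \dim S = 2%N ->
      exists G : one_edge_graph R, exists S' : {vspace 'M[R[i]]_2},
        [/\ listed G, is_loopfree_complement q (edge_space q G) S'
          & isomorphic q S S']
  & \dim S = 3%N ->
      [set` S] = kms_perp q <[1%:M]>%VS].
Proof.
have q0 : 0 < q by case/andP: hq.
split=> [|dS|dS]; last 1 first.
(* Loopfreeness places [S] inside the complement of the unit, and dimension 3 gives equality. *)
- rewrite (kms_perp_line hq _ dS) // mx2_1 mx2_0.
  by apply/eqP => /mx2_inj[/eqP]; rewrite oner_eq0.
- split; first exact: one_edge_classification.
    have gns := kms_gns_undirected_G1B hq.
    by split; [exact: A1B_adjacency | exact: gns | case: gns].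
  move=> beta gamma adm; split; first exact: A1C_adjacency.
    exact: not_gns_undirected_G1C.
  exact: kms_undirected_G1C_iff.
exact: two_edge_classification.
Qed.
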